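(* Thompson's group $F$, i.e. the group of all orientation preserving piecewise linear homeomorphisms of $[0,1]$ all of whose slopes lie in $2^{\mathbb Z}=\{2^k\mid k\in\mathbb Z\}$ and all of whose breaks lie in $\mathbb Z[2^{-1}]$ (the dyadic rationals), is invariably generated.
   Context: Piecewise linear homeomorphisms of $[0,1]$ have finitely many breaks, a break being a point of $(0,1)$ at which the map is not differentiable; the group operation is composition. A subgroup $H$ of a group $G$ is called classful if for every $g\in G$ some conjugate of $g$ in $G$ lies in $H$, equivalently $\bigcup_{g\in G} gHg^{-1}=G$. A group $G$ is invariably generated if it has no classful subgroup other than $G$ itself. *)

(* Defs.v *)
From HB Require Import structures.
From mathcomp Require Import all_boot all_order all_algebra.
From mathcomp Require Import all_classical all_reals all_analysis.
From mathcomp Require Import ring lra.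

Set Implicit Arguments.
Unset Strict Implicit.
Unset Printing Implicit Defensive.

Import Order.TTheory GRing.Theory Num.Theory.
Import numFieldNormedType.Exports.

Local Open Scope ring_scope.
Local Open Scope classical_set_scope.

Definition subgroup (G : groupType) (H : set G) : Prop :=
  group_closed (mem H).

Definition classful (G : groupType) (H : set G) : Prop :=
  forall g : G, exists h : G, (g ^ h)%g \in H.

Definition invariably_generated (G : groupType) : Prop :=
  forall H : set G, subgroup H -> classful H -> H = [set: G].

Section PiecewiseLinear.
Context {R : realType}.
Implicit Types (f g : R -> R) (x y : R).

Definition homeo01 f : Prop := exists g,
  [/\ {homo f : x / x \in `[0, 1]%R}, {homo g : x / x \in `[0, 1]%R},
      {in `[0, 1]%R, cancel f g} /\ {in `[0, 1]%R, cancel g f},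
      {within `[0, 1], continuous f} & {within `[0, 1], continuous g}].

Definition orientation_preserving f : Prop :=
  {in `[0, 1]%R &, {homo f : x y / x < y}}.

Definition affine_on (a b : R) f : Prop :=
  exists m c : R, {in `[a, b]%R, forall x, f x = m * x + c}.

(* There are finitely many points of [0, 1] such that f is affine on every
   subinterval whose interior contains none of them. *)
Definition piecewise_linear f : Prop := exists2 S : set R, finite_set S &
  forall a b, 0 <= a -> a < b -> b <= 1 ->
    S `&` `]a, b[ = set0 -> affine_on a b f.

Definition breaks f : set R :=
  [set x | 0 < x < 1 /\ ~ derivable f x 1].

Definition slopes f : set R :=
  [set m | exists x, [/\ 0 < x < 1, derivable f x 1 & f^`() x = m]].

Definition dyadic : set R :=
  [set x | exists (a : int) (n : nat), x = a%:~R / 2 ^+ n].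

Definition powers2 : set R := [set x | exists k : int, x = 2 ^ k].

(* A map of [0, 1] to itself is encoded by its extension to R by the identity
   outside [0, 1]; the last clause makes this encoding unique, so that equality
   of functions on R is equality of maps of [0, 1]. *)
Definition thompson_map f : Prop :=
  [/\ homeo01 f /\ orientation_preserving f, piecewise_linear f,
      slopes f `<=` powers2, breaks f `<=` dyadic &
      forall x, x \notin `[0, 1]%R -> f x = x].

End PiecewiseLinear.

Record thompsonF (R : realType) := ThompsonF {
  thompson_fun :> R -> R ;
  thompsonP : thompson_map thompson_fun }.

Lemma thompsonF_inj (R : realType) (f g : thompsonF R) : f =1 g -> f = g.
Proof.
case: f g => [f fP] [g gP] /= /funext fg; subst g.
by rewrite (Prop_irrelevance fP gP).
Qed.

Section Closure.
Context {R : realType}.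
Implicit Types (f g : R -> R) (x y m n : R).

Lemma dyadic0 : dyadic (0 : R).
Proof. by exists 0, 0%N; rewrite mul0r. Qed.

Lemma dyadicD x y : dyadic x -> dyadic y -> dyadic (x + y).
Proof.
move=> [a [i ->]] [b [j ->]].
exists (a * 2 ^+ j + b * 2 ^+ i), (i + j)%N.
rewrite rmorphD !rmorphM /= !rmorphXn /= exprD.
have u : (2 ^+ i : R) != 0 by rewrite expf_neq0.
have v : (2 ^+ j : R) != 0 by rewrite expf_neq0.
by field; rewrite u v.
Qed.

Lemma dyadicN x : dyadic x -> dyadic (- x).
Proof. by move=> [a [i ->]]; exists (- a), i; rewrite rmorphN mulNr. Qed.

Lemma dyadicB x y : dyadic x -> dyadic y -> dyadic (x - y).
Proof. by move=> dx dy; apply: dyadicD => //; exact: dyadicN. Qed.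

Lemma dyadicM m x : powers2 m -> dyadic x -> dyadic (m * x).
Proof.
move=> [[k|k] ->] [a [i ->]].
  by exists (a * 2 ^+ k), i; rewrite rmorphM /= rmorphXn /= -exprnP; ring.
exists a, (i + k.+1)%N; rewrite exprD NegzE -exprnN.
have u : (2 ^+ i : R) != 0 by rewrite expf_neq0.
have v : (2 ^+ k.+1 : R) != 0 by rewrite expf_neq0.
by field; rewrite u v.
Qed.

Lemma powers2_gt0 m : powers2 m -> 0 < m.
Proof. by move=> [k ->]; rewrite exprz_gt0. Qed.

Lemma powers2M m n : powers2 m -> powers2 n -> powers2 (m * n).
Proof. by move=> [j ->] [k ->]; exists (j + k); rewrite expfzDr. Qed.

Lemma powers2V m : powers2 m -> powers2 m^-1.
Proof. by move=> [j ->]; exists (- j); rewrite invr_expz. Qed.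

(* f is affine with slope m on some [x, x + e], resp. [x - e, x]. *)
Definition rgerm f x m := exists2 e, 0 < e &
  forall y, x <= y <= x + e -> f y = f x + m * (y - x).
Definition lgerm f x m := exists2 e, 0 < e &
  forall y, x - e <= y <= x -> f y = f x + m * (y - x).

Lemma rgerm_derive f x m : rgerm f x m -> derivable f x 1 -> f^`() x = m.
Proof.
move=> [e e0 fe] df; rewrite derive1E.
apply/esym/(@cvg_unique _ _
  ((fun h => h^-1 *: (f (h *: 1 + x) - f x)) @ (0:R)^'+)) => //.
  apply: cvg_near_cst; near=> h.
  have h0 : 0 < h by near: h; exact: nbhs_right_gt.
  have he : h <= e by near: h; exact: nbhs_right_le.
  rewrite fe /GRing.scale /= ?mulr1; last by lra.
  have hn0 : h != 0 by rewrite gt_eqF.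
  by field.
exact: (cvg_dnbhs_at_right df).
Unshelve. all: by end_near. Qed.

Lemma lgerm_derive f x m : lgerm f x m -> derivable f x 1 -> f^`() x = m.
Proof.
move=> [e e0 fe] df; rewrite derive1E.
apply/esym/(@cvg_unique _ _
  ((fun h => h^-1 *: (f (h *: 1 + x) - f x)) @ (0:R)^'-)) => //.
  apply: cvg_near_cst; near=> h.
  have h0 : h < 0 by near: h; exact: nbhs_left_lt.
  have he : - e <= h by near: h; apply: nbhs_left_ge; rewrite oppr_lt0.
  rewrite fe /GRing.scale /= ?mulr1; last by lra.
  have hn0 : h != 0 by rewrite lt_eqF.
  by field.
exact: (cvg_dnbhs_at_left df).
Unshelve. all: by end_near. Qed.

Lemma germ_derivable f x m : lgerm f x m -> rgerm f x m -> derivable f x 1.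
Proof.
move=> [e e0 fe] [d d0 fd].
have H : \forall y \near x, f x + m * (y - x) = f y.
  have xed : x \in `]x - e, x + d[%R by rewrite in_itv /=; lra.
  near=> y.
  have : y \in `]x - e, x + d[%R by near: y; exact: near_in_itvoo.
  rewrite in_itv /= => /andP[/ltW y1 /ltW y2].
  case: (leP y x) => xy; first by rewrite (fe y) ?y1.
  by rewrite (fd y) ?y2 ?(ltW xy).
apply: (near_eq_derivable H).
apply/derivable1_diffP; apply: differentiableD; first exact: differentiable_cst.
apply: differentiableM; first exact: differentiable_cst.
apply: differentiableB => //; exact: differentiable_cst.
Unshelve. all: by end_near. Qed.


Lemma seq_gap_right (s : seq R) x b : x < b ->
  exists2 c, x < c <= b & forall z, z \in s -> ~~ (x < z < c).
Proof.
elim: s => [|z s IH] xb; first by exists b => //; rewrite xb lexx.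
have [c cb sc] := IH xb.
have [zc|zc] := boolP (x < z < c).
  exists z; first lra.
  move=> w; rewrite inE => /orP[/eqP ->|/sc]; first lra.
  by apply: contra; lra.
by exists c => // w; rewrite inE => /orP[/eqP ->|/sc].
Qed.

Lemma seq_gap_left (s : seq R) a x : a < x ->
  exists c, [/\ a <= c < x, c = a \/ c \in s &
                forall z, z \in s -> ~~ (c < z < x)].
Proof.
elim: s => [|z s IH] ax; first by exists a; split => //; [lra|left].
have [c [cb cs sc]] := IH ax.
have [zc|zc] := boolP (c < z < x).
  exists z; split; [lra|by right; rewrite mem_head|].
  move=> w; rewrite inE => /orP[/eqP ->|/sc]; first lra.
  by apply: contra; lra.
exists c; split => //; last by move=> w; rewrite inE => /orP[/eqP ->|/sc].
by case: cs => [->|cs]; [left|right; rewrite inE cs orbT].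
Qed.

Lemma pl_seq f : piecewise_linear f -> exists s : seq R, forall a b,
  0 <= a -> a < b -> b <= 1 -> (forall z, z \in s -> ~~ (a < z < b)) ->
  affine_on a b f.
Proof.
move=> [S /finite_seqP[s ->]] Sf; exists s => a b a0 ab b1 sab.
apply: Sf => //; rewrite -subset0 => z [/= zs].
by rewrite in_itv /= => zab; have := sab _ zs; rewrite zab.
Qed.

Lemma affine_germ a b f : a < b -> affine_on a b f ->
  exists m,
  [/\ rgerm f a m, lgerm f b m & f b - m * b = f a - m * a].
Proof.
move=> ab [m [c fE]]; exists m; split.
- exists (b - a); first lra.
  by move=> y yab; rewrite !fE ?in_itv /=; lra.
- exists (b - a); first lra.
  by move=> y yab; rewrite !fE ?in_itv /=; lra.
- by rewrite !fE ?in_itv /=; lra.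
Qed.

Lemma pl_rgerm f x : piecewise_linear f -> 0 <= x < 1 -> exists m, rgerm f x m.
Proof.
move=> /pl_seq[s sf] /andP[x0 x1].
have [c /andP[xc c1] sc] := seq_gap_right s x1.
have [m [fm _ _]] := affine_germ xc (sf _ _ x0 xc c1 sc).
by exists m.
Qed.

Lemma pl_lgerm f x : piecewise_linear f -> 0 < x <= 1 -> exists m, lgerm f x m.
Proof.
move=> /pl_seq[s sf] /andP[x0 x1].
have [c [/andP[xc c1] _ sc]] := seq_gap_left s x0.
have [m [_ fm _]] := affine_germ c1 (sf _ _ xc c1 x1 sc).
by exists m.
Qed.

Lemma rgerm_slope f x m : slopes f `<=` powers2 -> 0 <= x < 1 ->
  rgerm f x m -> powers2 m.
Proof.
move=> fs x01 [e e0 fe].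
have [d d0 /andP[de dx]] : exists2 d, 0 < d & (d + d <= e) && (x + d < 1).
  have [h|h] := leP (e / 2) ((1 - x) / 2); [exists (e / 2)|exists ((1 - x) / 2)]; lra.
have fl : lgerm f (x + d) m.
  by exists d => // y yd; rewrite (fe y) ?(fe (x + d)); [ring|lra|lra].
have fr : rgerm f (x + d) m.
  by exists d => // y yd; rewrite (fe y) ?(fe (x + d)); [ring|lra|lra].
have df := germ_derivable fl fr.
apply: fs; exists (x + d); split => //; [lra|exact: rgerm_derive].
Qed.

Lemma lgerm_slope f x m : slopes f `<=` powers2 -> 0 < x <= 1 ->
  lgerm f x m -> powers2 m.
Proof.
move=> fs x01 [e e0 fe].
have [d d0 /andP[de dx]] : exists2 d, 0 < d & (d + d <= e) && (0 < x - d).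
  have [h|h] := leP (e / 2) (x / 2); [exists (e / 2)|exists (x / 2)]; lra.
have fl : lgerm f (x - d) m.
  by exists d => // y yd; rewrite (fe y) ?(fe (x - d)); [ring|lra|lra].
have fr : rgerm f (x - d) m.
  by exists d => // y yd; rewrite (fe y) ?(fe (x - d)); [ring|lra|lra].
have df := germ_derivable fl fr.
apply: fs; exists (x - d); split => //; [lra|exact: rgerm_derive].
Qed.

Lemma rgerm_comp f g x m n : 0 < m -> rgerm f x m -> rgerm g (f x) n ->
  rgerm (g \o f) x (n * m).
Proof.
move=> m0 [e e0 fe] [d d0 gd].
have dm : 0 < d / m by rewrite divr_gt0.
exists (Num.min e (d / m)); first by rewrite lt_min e0.
move=> y /andP[xy]; rewrite -lerBlDl le_min ler_pdivlMr // => /andP[ye yd].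
have my : 0 <= m * (y - x) by rewrite mulr_ge0; lra.
rewrite /= (fe y); last lra.
by rewrite (gd (f x + _)); [ring|lra].
Qed.

Lemma lgerm_comp f g x m n : 0 < m -> lgerm f x m -> lgerm g (f x) n ->
  lgerm (g \o f) x (n * m).
Proof.
move=> m0 [e e0 fe] [d d0 gd].
have dm : 0 < d / m by rewrite divr_gt0.
exists (Num.min e (d / m)); first by rewrite lt_min e0.
move=> y /andP[xy yx].
have : x - y <= Num.min e (d / m) by lra.
rewrite le_min ler_pdivlMr // => /andP[ye yd].
have my : 0 <= m * (x - y) by rewrite mulr_ge0; lra.
rewrite /= (fe y); last lra.
by rewrite (gd (f x + _)); [ring|lra].
Qed.

Lemma rgerm_inv f g x m : cancel f g -> 0 < m -> rgerm f x m ->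
  rgerm g (f x) m^-1.
Proof.
move=> fg m0 [e e0 fe]; have mn0 : m != 0 by rewrite gt_eqF.
exists (e * m); first by rewrite mulr_gt0.
move=> y /andP[y1 y2].
have z1 : 0 <= m^-1 * (y - f x) by rewrite mulr_ge0 ?invr_ge0; lra.
have z2 : m^-1 * (y - f x) <= e by rewrite mulrC ler_pdivrMr; lra.
have yE : y = f (x + m^-1 * (y - f x)) by rewrite (fe (x + _)); [field|lra].
by rewrite {1}yE !fg.
Qed.

Lemma lgerm_inv f g x m : cancel f g -> 0 < m -> lgerm f x m ->
  lgerm g (f x) m^-1.
Proof.
move=> fg m0 [e e0 fe]; have mn0 : m != 0 by rewrite gt_eqF.
exists (e * m); first by rewrite mulr_gt0.
move=> y /andP[y1 y2].
have z1 : 0 <= m^-1 * (f x - y) by rewrite mulr_ge0 ?invr_ge0; lra.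
have z2 : m^-1 * (f x - y) <= e by rewrite mulrC ler_pdivrMr; lra.
have yE : y = f (x + m^-1 * (y - f x)) by rewrite (fe (x + _)); [field|lra].
by rewrite {1}yE !fg.
Qed.

Definition homeo_pair f g :=
  [/\ cancel f g /\ cancel g f,
      {homo f : x y / x < y}, {homo g : x y / x < y},
      (forall x, x \notin `[0, 1]%R -> f x = x) /\
      (forall x, x \notin `[0, 1]%R -> g x = x) &
      {within `[0, 1], continuous f} /\ {within `[0, 1], continuous g}].

Lemma homeo_pair_sym f g : homeo_pair f g -> homeo_pair g f.
Proof. by move=> [[? ?] ? ? [? ?] [? ?]]. Qed.

Lemma homeo_pair_in f g x : homeo_pair f g -> 
  x \in `[0, 1]%R -> f x \in `[0, 1]%R.
Proof.
move=> [[fg gf] _ _ [_ gid] _]; apply: contraTT => /[dup] fx /gid.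
by rewrite fg => ->.
Qed.

Lemma homeo_pair0 f g : homeo_pair f g -> f 0 = 0.
Proof.
move=> fg; have I0 : (0 : R) \in `[0, 1]%R by rewrite in_itv /=; lra.
have := homeo_pair_in fg I0.
have := homeo_pair_in (homeo_pair_sym fg) I0.
case: fg => [[_ gf] fm _ _ _]; rewrite !in_itv /= => /andP[g0 _] /andP[f0 _].
move: g0; rewrite le_eqVlt => /orP[/eqP e|/fm]; first by rewrite {1}e gf.
by rewrite gf; lra.
Qed.

Lemma homeo_pair1 f g : homeo_pair f g -> f 1 = 1.
Proof.
move=> fg; have I0 : (1 : R) \in `[0, 1]%R by rewrite in_itv /=; lra.
have := homeo_pair_in fg I0.
have := homeo_pair_in (homeo_pair_sym fg) I0.
case: fg => [[_ gf] fm _ _ _]; rewrite !in_itv /= => /andP[_ g0] /andP[_ f0].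
move: g0; rewrite le_eqVlt => /orP[/eqP e|/fm]; first by rewrite -{1}e gf.
by rewrite gf; lra.
Qed.

Lemma homeo_pair_oo f g x : homeo_pair f g -> 0 < x < 1 -> 0 < f x < 1.
Proof.
move=> fg; have := homeo_pair0 fg; have := homeo_pair1 fg.
case: fg => [_ fm _ _ _] f1 f0 /andP[/fm + /fm].
by rewrite f0 f1 => -> ->.
Qed.

Lemma homeo_pair_co f g x : homeo_pair f g -> 0 <= x < 1 -> 0 <= f x < 1.
Proof.
move=> fg /andP[]; rewrite le_eqVlt => /orP[/eqP <- _|x0 x1].
  by rewrite (homeo_pair0 fg) lexx ltr01.
by have /andP[/ltW -> ->] := homeo_pair_oo fg (introT andP (conj x0 x1)).
Qed.

Lemma homeo_pair_oc f g x : homeo_pair f g -> 0 < x <= 1 -> 0 < f x <= 1.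
Proof.
move=> fg /andP[x0]; rewrite le_eqVlt => /orP[/eqP ->|x1].
  by rewrite (homeo_pair1 fg) lexx ltr01.
by have /andP[-> /ltW ->] := homeo_pair_oo fg (introT andP (conj x0 x1)).
Qed.

Lemma thompson_homeo_pair f : thompson_map f -> exists g, homeo_pair f g.
Proof.
move=> [[[g [fI gI [fg gf] cf cg]] fm] _ _ _ fid].
pose h x := if x \in `[0, 1]%R then g x else x.
have fh : cancel f h.
  move=> x; rewrite /h; have [xI|xI] := boolP (x \in `[0, 1]%R).
    by rewrite fI // fg.
  by rewrite fid // (negPf xI).
have hf : cancel h f.
  move=> x; rewrite /h; have [xI|xI] := boolP (x \in `[0, 1]%R).
    by rewrite gf.
  by rewrite fid.
have fM : {homo f : x y / x < y}.
  move=> x y xy.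
  have [xI|xI] := boolP (x \in `[0, 1]%R);
    have [yI|yI] := boolP (y \in `[0, 1]%R); last 1 first.
  - by rewrite !fid.
  - exact: fm.
  - rewrite (fid y) //; have := fI _ xI; move: xI yI.
    by rewrite !in_itv /=; lra.
  - rewrite (fid x) //; have := fI _ yI; move: xI yI.
    by rewrite !in_itv /=; lra.
exists h; split => //.
- move=> x y xy; rewrite ltNge le_eqVlt; apply/norP; split.
    by apply/eqP => /(congr1 f); rewrite !hf; lra.
  by apply/negP => /fM; rewrite !hf; lra.
- by split => // x xI; rewrite /h (negPf xI).
- split => //; apply: (subspace_eq_continuous _ cg) => x.
  by move=> /set_mem xI; change (g x = h x); rewrite /h ifT.
Qed.

Lemma homeo_pair_thompson f g : homeo_pair f g -> piecewise_linear f ->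
  slopes f `<=` powers2 -> breaks f `<=` dyadic -> thompson_map f.
Proof.
move=> fg fpl fs fb; have := fg.
move=> [[fgK gfK] fm gm [fid gid] [cf cg]]; split => //; split; last first.
  by move=> x y _ _; exact: fm.
exists g; split => //.
- by move=> x; exact: (homeo_pair_in fg).
- by move=> x; exact: (homeo_pair_in (homeo_pair_sym fg)).
- by split => x _.
Qed.

Lemma dyadic_germ f k (s : seq R) x m : f 0 = 0 ->
  slopes f `<=` powers2 -> breaks f `<=` dyadic -> (size s < k)%N ->
  0 <= x < 1 ->
  (forall a b, 0 <= a -> a < b -> b <= x ->
    (forall z, z \in s -> ~~ (a < z < b)) -> affine_on a b f) ->
  rgerm f x m -> dyadic (f x - m * x).
Proof.
move=> f0 fs fb; elim: k s x m => // k IH s x m sk /andP[x0 x1] sf fx.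
move: x0; rewrite le_eqVlt => /orP[/eqP <-|x0].
  by rewrite f0 mulr0 subr0; exact: dyadic0.
have [q [/andP[q0 qx] qs sq]] := seq_gap_left s x0.
have [m' [fq fx' fE]] := affine_germ qx (sf _ _ q0 qx (lexx x) sq).
have m2 : powers2 m by apply: (rgerm_slope fs _ fx); lra.
have m2' : powers2 m' by apply: (lgerm_slope fs _ fx'); lra.
have dq : dyadic (f x - m' * x).
  rewrite fE; case: qs => [->|qs].
    by rewrite f0 mulr0 subr0; exact: dyadic0.
  apply: (IH [seq z <- s | z < q]) fq; last 2 first.
  - lra.
  - move=> a b a0 ab bq sab; apply: sf => //; first lra.
    move=> z zs; have [zq|zq] := ltP z q; last lra.
    by apply: sab; rewrite mem_filter zq.
  - apply: (@leq_trans (size s)); last by rewrite -ltnS.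
    rewrite size_filter ltn_neqAle count_size andbT.
    by rewrite -all_count; apply/allPn; exists q => //; rewrite ltxx.
have [df|df] := pselect (derivable f x 1).
  by rewrite -(rgerm_derive fx df) (lgerm_derive fx' df).
have dx : dyadic x by apply: fb; split => //; lra.
have -> : f x - m * x = f x - m' * x + m' * x - m * x by ring.
by apply: dyadicB; [apply: dyadicD => //|]; exact: dyadicM.
Qed.

Lemma thompson_dyadic f x : thompson_map f -> 0 <= x < 1 ->
  dyadic (f x) <-> dyadic x.
Proof.
move=> fT x01; have [g fg] := thompson_homeo_pair fT.
case: fT => [_ fpl fs fb _].
have [s sf] := pl_seq fpl.
have [m fm] := pl_rgerm fpl x01.
have m2 := rgerm_slope fs x01 fm.
have df : dyadic (f x - m * x).
  apply: (@dyadic_germ f (size s).+1 s) => //; first exact: homeo_pair0 fg.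
  by move=> a b a0 ab bx; apply: sf => //; lra.
split=> dx.
  have -> : x = m^-1 * (f x - (f x - m * x)).
    by have mn0 := lt0r_neq0 (powers2_gt0 m2); field.
  by apply: dyadicM; [exact: powers2V|exact: dyadicB].
have -> : f x = (f x - m * x) + m * x by ring.
by apply: dyadicD => //; exact: dyadicM.
Qed.

Lemma thompson_map_id : thompson_map (@id R).
Proof.
have idI : homeo_pair (@id R) id.
  split => //; split => //; apply: continuous_subspaceT => x; exact: cvg_id.
have germ x : lgerm id x 1 /\ rgerm (@id R) x 1.
  by split; exists 1 => // y _; ring.
apply: homeo_pair_thompson idI _ _ _.
- by exists set0 => // a b _ _ _ _; exists 1, 0 => x _; rewrite mul1r addr0.
- move=> _ [x [_ dx <-]]; exists 0; rewrite expr0z.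
  by apply: rgerm_derive dx; case: (germ x).
- move=> x [_]; have [l r] := germ x.
  by move/(_ (germ_derivable l r)).
Qed.

Lemma thompson_map_comp f g :
  thompson_map f -> thompson_map g -> thompson_map (g \o f).
Proof.
move=> fT gT; have [fi fp] := thompson_homeo_pair fT.
have [gi gp] := thompson_homeo_pair gT.
have [_ fpl fs fb _] := fT; have [_ gpl gs gb _] := gT.
have hp : homeo_pair (g \o f) (fi \o gi).
  move: (fp) (gp) => [[ffi fif] fm fim [fid fiid] [cf cfi]].
  move=> [[ggi gig] gm gim [gid giid] [cg cgi]].
  split.
  - by split => x /=; rewrite ?ggi ?ffi ?fif ?gig.
  - by move=> x y /fm/gm.
  - by move=> x y /gim/fim.
  - by split => x xI /=; rewrite ?(fid x) ?(gid x) ?(giid x) ?(fiid x).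
  - have cc (u v : R -> R) :
        (forall x, x \in `[0, 1]%R -> u x \in `[0, 1]%R) ->
        {within `[0, 1], continuous u} -> {within `[0, 1], continuous v} ->
        {within `[0, 1], continuous (v \o u)}.
      move=> uI /subspace_continuousP cu /subspace_continuousP cv.
      apply/subspace_continuousP => x xI.
      apply: (@cvg_comp _ _ _ u v _ (within `[0, 1] (nbhs (u x))) _ _ (cv _ (uI _ xI))).
      move=> A nA.
      have H : nbhs x [set y | `[0, 1] y -> `[0, 1] (u y) -> A (u y)].
        exact: cu _ xI _ nA.
      apply: (@filterS _ (nbhs x) _ _ _ _ H) => y {}H yI.
      by apply: H => //; exact: uI.
    split; apply: cc => // x.
      exact: (homeo_pair_in fp).
    exact: (homeo_pair_in (homeo_pair_sym gp)).
have rg x : 0 <= x < 1 -> exists m n, [/\ powers2 m, powers2 n,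
    rgerm f x m, rgerm g (f x) n & rgerm (g \o f) x (n * m)].
  move=> x01; have [m fm] := pl_rgerm fpl x01.
  have fx01 := homeo_pair_co fp x01.
  have [n gn] := pl_rgerm gpl fx01.
  have m2 := rgerm_slope fs x01 fm; have n2 := rgerm_slope gs fx01 gn.
  exists m, n; split => //; apply: rgerm_comp => //; exact: powers2_gt0.
have lg x : 0 < x <= 1 -> exists m n, [/\ powers2 m, powers2 n,
    lgerm f x m, lgerm g (f x) n & lgerm (g \o f) x (n * m)].
  move=> x01; have [m fm] := pl_lgerm fpl x01.
  have fx01 := homeo_pair_oc fp x01.
  have [n gn] := pl_lgerm gpl fx01.
  have m2 := lgerm_slope fs x01 fm; have n2 := lgerm_slope gs fx01 gn.
  exists m, n; split => //; apply: lgerm_comp => //; exact: powers2_gt0.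
apply: homeo_pair_thompson hp _ _ _.
- move: (fp) (gp) => [[ffi fif] fm fim _ _] [_ gm _ _ _].
  move: fpl gpl => [S Sfin Sf] [T Tfin Tg].
  exists (S `|` fi @` T); first by rewrite finite_setU; split => //; exact: finite_image.
  move=> a b a0 ab b1 /seteqP[H _].
  have aI : 0 <= f a by case/andP: (homeo_pair_co fp (x := a) ltac:(lra)).
  have bI : f b <= 1 by case/andP: (homeo_pair_oc fp (x := b) ltac:(lra)).
  have [|m [c fE]] := Sf a b a0 ab b1.
    by rewrite -subset0 => z [Sz zab]; apply: (H z); split => //; left.
  have [|n [d gE]] := Tg (f a) (f b) aI (fm _ _ ab) bI.
    rewrite -subset0 => z [Tz]; rewrite /= in_itv /= => /andP[za zb].
    apply: (H (fi z)); split; first by right; exists z.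
    by rewrite /= in_itv /= -(ffi a) -(ffi b) !fim.
  exists (n * m), (n * c + d) => x xab /=; rewrite gE.
    by rewrite fE //; ring.
  move: xab; rewrite !in_itv /= !le_eqVlt.
  move=> /andP[/orP[/eqP <-|/fm ->] /orP[/eqP ->|/fm ->]];
    by rewrite ?eqxx ?orbT ?(fm _ _ ab) ?orbT.
- move=> _ [x [x01 dx <-]].
  have [|m [n [m2 n2 _ _ gf]]] := rg x; first lra.
  by rewrite (rgerm_derive gf dx); exact: powers2M.
- move=> x [x01 ndx].
  have [|m [n [m2 n2 fr gr r]]] := rg x; first lra.
  have [|m' [n' [_ _ fl gl l]]] := lg x; first lra.
  have [df|ndf] := pselect (derivable f x 1); last by apply: fb.
  have [dg|ndg] := pselect (derivable g (f x) 1).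
    exfalso; apply: ndx; apply: germ_derivable l _.
    rewrite -(lgerm_derive fl df) -(lgerm_derive gl dg).
    by rewrite (rgerm_derive fr df) (rgerm_derive gr dg).
  apply/(thompson_dyadic fT); first lra.
  by apply: gb; split => //; exact: (homeo_pair_oo fp).
Qed.

Lemma thompson_map_inv f g :
  thompson_map f -> homeo_pair f g -> thompson_map g.
Proof.
move=> fT fp; have gp := homeo_pair_sym fp.
have [_ fpl fs fb _] := fT.
have [[fg gf] fm gm _ _] := fp.
have rg x : 0 <= x < 1 -> exists m, [/\ powers2 m,
    rgerm f (g x) m & rgerm g x m^-1].
  move=> x01; have gx01 := homeo_pair_co gp x01.
  have [m r] := pl_rgerm fpl gx01; have m2 := rgerm_slope fs gx01 r.
  exists m; split => //; have := rgerm_inv fg (powers2_gt0 m2) r.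
  by rewrite gf.
have lg x : 0 < x <= 1 -> exists m, [/\ powers2 m,
    lgerm f (g x) m & lgerm g x m^-1].
  move=> x01; have gx01 := homeo_pair_oc gp x01.
  have [m r] := pl_lgerm fpl gx01; have m2 := lgerm_slope fs gx01 r.
  exists m; split => //; have := lgerm_inv fg (powers2_gt0 m2) r.
  by rewrite gf.
apply: homeo_pair_thompson (gp) _ _ _.
- move: fpl => [S Sfin Sf].
  exists (f @` S); first exact: finite_image.
  move=> a b a0 ab b1 /seteqP[H _].
  have aI : 0 <= g a by case/andP: (homeo_pair_co gp (x := a) ltac:(lra)).
  have bI : g b <= 1 by case/andP: (homeo_pair_oc gp (x := b) ltac:(lra)).
  have [|m [c fE]] := Sf (g a) (g b) aI (gm _ _ ab) bI.
    rewrite -subset0 => z [Sz]; rewrite /= in_itv /= => /andP[za zb].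
    apply: (H (f z)); split; first by exists z.
    by rewrite /= in_itv /= -(gf a) -(gf b) !fm.
  have mn0 : m != 0.
    apply/eqP => m0; have := fm _ _ (gm _ _ ab).
    rewrite !fE ?in_itv /= ?lexx ?(ltW (gm _ _ ab)) //.
    by rewrite m0; lra.
  exists m^-1, (- (m^-1 * c)) => x xab.
  have -> : m^-1 * x + - (m^-1 * c) = m^-1 * (f (g x) - c) by rewrite gf; ring.
  rewrite fE; first by field.
  move: xab; rewrite !in_itv /= !le_eqVlt.
  move=> /andP[/orP[/eqP <-|/gm ->] /orP[/eqP ->|/gm ->]];
    by rewrite ?eqxx ?orbT ?(gm _ _ ab) ?orbT.
- move=> _ [x [x01 dx <-]].
  have [|m [m2 _ gr]] := rg x; first lra.
  by rewrite (rgerm_derive gr dx); exact: powers2V.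
- move=> x [x01 ndx].
  have [|m [m2 fr gr]] := rg x; first lra.
  have [|m' [m2' fl gl]] := lg x; first lra.
  have gx01 := homeo_pair_oo gp x01.
  have gx01' : 0 <= g x < 1 by lra.
  rewrite -(gf x); apply/(thompson_dyadic fT gx01').
  have [df|ndf] := pselect (derivable f (g x) 1); last by apply: fb.
  exfalso; apply: ndx; apply: germ_derivable gl _.
  by rewrite -(lgerm_derive fl df) (rgerm_derive fr df).
Qed.

Lemma thompson_inv_exists (f : thompsonF R) :
  exists g : thompsonF R, cancel f g /\ cancel g f.
Proof.
have [g fg] := thompson_homeo_pair (thompsonP f).
exists (ThompsonF (thompson_map_inv (thompsonP f) fg)).
by case: fg.
Qed.

End Closure.

Section ThompsonGroup.
Context {R : realType}.
Implicit Types f g : thompsonF R.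

Definition thompson_one : thompsonF R := ThompsonF thompson_map_id.

Definition thompson_mul f g : thompsonF R :=
  ThompsonF (thompson_map_comp (thompsonP g) (thompsonP f)).

Definition thompson_inv f : thompsonF R := sval (cid (thompson_inv_exists f)).

Lemma thompson_funK f : cancel f (thompson_inv f).
Proof. by rewrite /thompson_inv; case: cid => g []. Qed.

Lemma thompson_invK f : cancel (thompson_inv f) f.
Proof. by rewrite /thompson_inv; case: cid => g []. Qed.

Lemma thompson_mulA : associative thompson_mul.
Proof. by move=> f g h; exact: thompsonF_inj. Qed.

Lemma thompson_mul1 : left_id thompson_one thompson_mul.
Proof. by move=> f; exact: thompsonF_inj. Qed.

Lemma thompson_mulr1 : right_id thompson_one thompson_mul.
Proof. by move=> f; exact: thompsonF_inj. Qed.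

Lemma thompson_mulV : left_inverse thompson_one thompson_inv thompson_mul.
Proof. by move=> f; apply: thompsonF_inj => x /=; rewrite thompson_funK. Qed.

Lemma thompson_mulrV : right_inverse thompson_one thompson_inv thompson_mul.
Proof. by move=> f; apply: thompsonF_inj => x /=; rewrite thompson_invK. Qed.

HB.instance Definition _ := gen_eqMixin (thompsonF R).
HB.instance Definition _ := gen_choiceMixin (thompsonF R).
HB.instance Definition _ := isGroup.Build (thompsonF R)
  thompson_mulA thompson_mul1 thompson_mulr1 thompson_mulV thompson_mulrV.

Lemma thompson1E x : (1%g : thompsonF R) x = x.
Proof. by []. Qed.

Lemma thompsonME f g x : (f * g)%g x = f (g x).
Proof. by []. Qed.

End ThompsonGroup.

(* Main.v *)
(* Let H be classful. Commutators in F are trivial near 0 and near 1, so every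
   g in F is conjugate into H by some c which is trivial near 0 and 1: if g^c
   and c^d lie in H, then so does the conjugate of g by c (c^d)^-1 = [c^-1, d].
   Given f supported in [e, 1 - e], some h in H satisfies x < h x on (0, 1) and
   1 - e < h e: take a power of a conjugate of a map with x < h x. Conjugate
   g = h f into H by such a c. For large n and m, the element
   h^-n (g^c)^(n + m) h^-m of H agrees with h^-n g^(n + m) h^-m = f on
   [e, 1 - e], because c only matters away from 0 and 1. So H approximates
   compactly supported elements on compact sets; undoing by such an
   approximation the conjugation that brings a compactly supported u into H
   shows that u is in H. Finally, any f in F differs from a conjugate in H by a
   commutator, which is compactly supported. *)
Require Import Defs.
From mathcomp Require Import all_boot all_reals.
From mathcomp Require Import all_order all_algebra all_classical all_analysis.
From mathcomp Require Import lra.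

Set Implicit Arguments.
Unset Strict Implicit.
Unset Printing Implicit Defensive.

Import Order.TTheory GRing.Theory Num.Theory.
Import numFieldNormedType.Exports.

Local Open Scope ring_scope.
Local Open Scope classical_set_scope.

(** * An explicit element of $F$ moving every point of $(0,1)$ to the right *)

Section PushMap.
Context {R : realType}.
Implicit Types x y : R.

(** Inverse of the usual generator $x_0$ of $F$, which is [pull]. Being concave, it is a minimum of
    affine maps, which makes its continuity immediate. *)
Definition push x : R := if x \in `[0, 1]%R
  then Num.min (2 * x) (Num.min (x + 4^-1) ((x + 1) / 2)) else x.

Definition pull x : R := if x \in `[0, 1]%R
  then Num.max (x / 2) (Num.max (x - 4^-1) (2 * x - 1)) else x.

Lemma push_spec x : [\/ 0 <= x <= 4^-1 /\ push x = 2 * x,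
  4^-1 <= x <= 2^-1 /\ push x = x + 4^-1,
  2^-1 <= x <= 1 /\ push x = (x + 1) / 2 | (x < 0) || (1 < x) /\ push x = x].
Proof.
rewrite /push in_itv /=; case: ifPn => xI; last by constructor 4; split => //; lra.
rewrite !minEle; have [h|h] := leP x 4^-1.
  constructor 1; split; first lra.
  by do 2?case: ifPn; lra.
have [h'|h'] := leP x 2^-1.
  constructor 2; split; first lra.
  by do 2?case: ifPn; lra.
constructor 3; split; first lra.
by do 2?case: ifPn; lra.
Qed.

Lemma pull_spec x : [\/ 0 <= x <= 2^-1 /\ pull x = x / 2,
  2^-1 <= x <= 3 / 4 /\ pull x = x - 4^-1,
  3 / 4 <= x <= 1 /\ pull x = 2 * x - 1 | (x < 0) || (1 < x) /\ pull x = x].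
Proof.
rewrite /pull in_itv /=; case: ifPn => xI; last by constructor 4; split => //; lra.
rewrite !maxEle; have [h|h] := leP x 2^-1.
  constructor 1; split; first lra.
  by do 2?case: ifPn; lra.
have [h'|h'] := leP x (3 / 4).
  constructor 2; split; first lra.
  by do 2?case: ifPn; lra.
constructor 3; split; first lra.
by do 2?case: ifPn; lra.
Qed.

Lemma push_gt x : 0 < x < 1 -> x < push x.
Proof. by have [] := push_spec x => -[]; lra. Qed.

Lemma push_homeo_pair : homeo_pair push pull.
Proof.
have within_eq (u v : R -> R) : continuous v -> {in `[0, 1]%R, u =1 v} ->
    {within `[0, 1], continuous u}.
  move=> cv uv; apply: (@subspace_eq_continuous _ _ _ v); last first.
    exact: continuous_subspaceT.
  by move=> x /set_mem xI; rewrite /from_subspace /= uv.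
split.
- split=> x.
    by have [] := push_spec x => -[?]; have [] := pull_spec (push x) => -[?]; lra.
  by have [] := pull_spec x => -[?]; have [] := push_spec (pull x) => -[?]; lra.
- move=> x y xy.
  by have [] := push_spec x => -[?]; have [] := push_spec y => -[?]; lra.
- move=> x y xy.
  by have [] := pull_spec x => -[?]; have [] := pull_spec y => -[?]; lra.
- by split=> x xI; rewrite /push /pull (negPf xI).
- split.
    apply: (within_eq _ ((fun x => 2 * x) \min ((fun x => x + 4^-1) \min (fun x => (x + 1) / 2)))).
      move=> x; apply: continuous_min; last apply: continuous_min.
      + by apply: cvgM; [exact: cvg_cst|exact: cvg_id].
      + by apply: cvgD; [exact: cvg_id|exact: cvg_cst].
      + apply: cvgM; last exact: cvg_cst.
        by apply: cvgD; [exact: cvg_id|exact: cvg_cst].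
    by move=> x xI; rewrite /push xI.
  apply: (within_eq _ ((fun x => x / 2) \max ((fun x => x - 4^-1) \max (fun x => 2 * x - 1)))).
    move=> x; apply: continuous_max; last apply: continuous_max.
    + by apply: cvgM; [exact: cvg_id|exact: cvg_cst].
    + by apply: cvgB; [exact: cvg_id|exact: cvg_cst].
    + apply: cvgB; last exact: cvg_cst.
      by apply: cvgM; [exact: cvg_cst|exact: cvg_id].
  by move=> x xI; rewrite /pull xI.
Qed.

Lemma push_affine a b : 0 <= a -> a < b -> b <= 1 ->
  [\/ b <= 4^-1, 4^-1 <= a /\ b <= 2^-1 | 2^-1 <= a] ->
  exists m c, powers2 m /\ {in `[a, b]%R, forall x, push x = m * x + c}.
Proof.
move=> a0 ab b1 [h|h|h].
- exists 2, 0; split; first by exists 1; rewrite expr1z.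
  by move=> x; rewrite in_itv /=; have [] := push_spec x => -[]; lra.
- exists 1, 4^-1; split; first by exists 0; rewrite expr0z.
  by move=> x; rewrite in_itv /=; have [] := push_spec x => -[]; lra.
- exists 2^-1, 2^-1; split; first by exists (-1); rewrite exprN1.
  by move=> x; rewrite in_itv /=; have [] := push_spec x => -[]; lra.
Qed.

Lemma push_thompson : thompson_map push.
Proof.
have dy n : dyadic ((2 ^+ n)^-1 : R) by exists 1, n; rewrite mul1r.
apply: homeo_pair_thompson push_homeo_pair _ _ _.
- exists [set 4^-1; 2^-1]; first by rewrite finite_setU; split; exact: finite_set1.
  move=> a b a0 ab b1 /seteqP[H _].
  have H4 : ~~ (a < 4^-1 < b).
    by apply/negP => h; apply: (H 4^-1); split; [left|rewrite /= in_itv].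
  have H2 : ~~ (a < 2^-1 < b).
    by apply/negP => h; apply: (H 2^-1); split; [right|rewrite /= in_itv].
  have [|m [c [_ mc]]] := push_affine a0 ab b1; last by exists m, c.
  have [h|h] := leP b 4^-1; first by constructor 1.
  by have [h'|h'] := leP b 2^-1; [constructor 2|constructor 3]; lra.
- move=> _ [x [x01 dx <-]].
  (* A linear piece to the right of [x] suffices: where [push] is derivable, its right slope is the
     derivative. *)
  have [b xb [b1 hb]] : exists2 b, x < b & b <= 1 /\
      [\/ b <= 4^-1, 4^-1 <= x /\ b <= 2^-1 | 2^-1 <= x].
    have [h|h] := ltP x 4^-1; first by exists 4^-1 => //; split; [lra|constructor 1].
    have [h'|h'] := ltP x 2^-1; first by exists 2^-1 => //; split; [lra|constructor 2].
    by exists 1; [lra|split => //; constructor 3].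
  have x0 : 0 <= x by lra.
  have [m [c [m2 mc]]] := push_affine x0 xb b1 hb.
  rewrite (@rgerm_derive _ push x m) //.
  exists (b - x); first lra.
  by move=> y xy; rewrite !mc ?in_itv /=; lra.
- move=> x [x01 ndx].
  have [->|x4] := eqVneq x 4^-1; first by have := dy 2%N; rewrite -natrX.
  have [->|x2] := eqVneq x 2^-1; first by have := dy 1%N; rewrite expr1.
  have [a [b [a0 ax xb b1 h]]] : exists a b, [/\ 0 <= a, a < x, x < b, b <= 1 &
      [\/ b <= 4^-1, 4^-1 <= a /\ b <= 2^-1 | 2^-1 <= a]].
    have [h|h] := ltP x 4^-1.
      by exists 0, 4^-1; split; [lra|lra|lra|lra|constructor 1].
    have [h'|h'] := ltP x 2^-1.
      by exists 4^-1, 2^-1; split; [lra|lra|lra|lra|constructor 2].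
    by exists 2^-1, 1; split; [lra|lra|lra|lra|constructor 3].
  have [m [c [_ mc]]] := push_affine a0 (lt_trans ax xb) b1 h.
  exfalso; apply: ndx; apply: (@germ_derivable _ _ _ m).
    exists (x - a); first lra.
    by move=> y xy; rewrite !mc ?in_itv /=; lra.
  exists (b - x); first lra.
  by move=> y xy; rewrite !mc ?in_itv /=; lra.
Qed.

End PushMap.

(** * Order, supports and commutators in $F$ *)

Section ThompsonAction.
Context {R : realType}.
Implicit Types (f g h c : thompsonF R) (x y z e : R).

Lemma thompson_le f : {mono f : x y / x <= y}.
Proof.
have [? [_ flt _ _ _]] := thompson_homeo_pair (thompsonP f).
exact: le_mono.
Qed.

Lemma thompson_lt f : {mono f : x y / x < y}.
Proof. exact: leW_mono (thompson_le f). Qed.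

Lemma thompson0 f : f 0 = 0.
Proof. by have [g /homeo_pair0] := thompson_homeo_pair (thompsonP f). Qed.

Lemma thompson1 f : f 1 = 1.
Proof. by have [g /homeo_pair1] := thompson_homeo_pair (thompsonP f). Qed.

Lemma thompson_out f x : x \notin `[0, 1]%R -> f x = x.
Proof. by case: (thompsonP f) => _ _ _ _; apply. Qed.

Lemma thompson_oo f x : 0 < x < 1 -> 0 < f x < 1.
Proof. by rewrite -{2}(thompson0 f) -{2}(thompson1 f) !thompson_lt. Qed.

Lemma thompsonK f : cancel f (f^-1)%g.
Proof. exact: thompson_funK. Qed.

Lemma thompsonVK f : cancel (f^-1)%g f.
Proof. exact: thompson_invK. Qed.

Definition fixes_ends e f := forall x, x <= e \/ 1 - e <= x -> f x = x.

Definition compactly_supported f := exists2 e, 0 < e & fixes_ends e f.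

Lemma fixes_endsW e e' f : e' <= e -> fixes_ends e f -> fixes_ends e' f.
Proof. by move=> ee' fe x xe; apply: fe; lra. Qed.

Lemma fixes_endsV e f : fixes_ends e f -> fixes_ends e (f^-1)%g.
Proof. by move=> fe x /fe fx; rewrite -{1}fx thompsonK. Qed.

Lemma fixes_endsM e f g : fixes_ends e f -> fixes_ends e g ->
  fixes_ends e (f * g)%g.
Proof. by move=> fe ge x xe; rewrite thompsonME (ge x) ?fe. Qed.

Lemma compactly_supported_common f g :
  compactly_supported f -> compactly_supported g ->
  exists e, [/\ 0 < e, e < 2^-1, fixes_ends e f & fixes_ends e g].
Proof.
(* The bound [4^-1] ensures [e < 2^-1], so that $[e, 1-e]$ is nondegenerate. *)
move=> [e e0 fe] [d d0 gd]; exists (Num.min 4^-1 (Num.min e d)).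
by split; rewrite ?lt_min ?gt_min ?e0 ?d0 ?andbT;
  [lra|lra|apply: fixes_endsW fe|apply: fixes_endsW gd]; rewrite !ge_min lexx !orbT.
Qed.

(** Near a fixed endpoint both maps are linear about it, so composing them multiplies their slopes,
    in either order. *)
Lemma commutator_compact f g : compactly_supported [~ f, g]%g.
Proof.
have [_ fpl fs _ _] := thompsonP f; have [_ gpl gs _ _] := thompsonP g.
have I0 : 0 <= (0 : R) < 1 by lra.
have I1 : 0 < (1 : R) <= 1 by lra.
have comm0 : exists2 e, 0 < e & forall x, x <= e -> f (g x) = g (f x).
  have [m fm] := pl_rgerm fpl I0; have [n gn] := pl_rgerm gpl I0.
  have m0 := powers2_gt0 (rgerm_slope fs I0 fm).
  have n0 := powers2_gt0 (rgerm_slope gs I0 gn).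
  have [|d d0 gfd] := rgerm_comp m0 fm (g := g) (n := n); first by rewrite thompson0.
  have [|e e0 fge] := rgerm_comp n0 gn (g := f) (n := m); first by rewrite thompson0.
  exists (Num.min d e) => [|x]; first by rewrite lt_min d0.
  rewrite le_min => /andP[xd xe]; have [x0|x0] := leP 0 x.
    move: (gfd x ltac:(lra)) (fge x ltac:(lra)); rewrite /= !thompson0 => -> ->.
    by rewrite mulrC; lra.
  by rewrite !(thompson_out _ (x := x)) ?in_itv /=; lra.
have comm1 : exists2 e, 0 < e & forall x, 1 - e <= x -> f (g x) = g (f x).
  have [m fm] := pl_lgerm fpl I1; have [n gn] := pl_lgerm gpl I1.
  have m0 := powers2_gt0 (lgerm_slope fs I1 fm).
  have n0 := powers2_gt0 (lgerm_slope gs I1 gn).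
  have [|d d0 gfd] := lgerm_comp m0 fm (g := g) (n := n); first by rewrite thompson1.
  have [|e e0 fge] := lgerm_comp n0 gn (g := f) (n := m); first by rewrite thompson1.
  exists (Num.min d e) => [|x]; first by rewrite lt_min d0.
  rewrite lerBlDr -lerBlDl le_min => /andP[xd xe]; have [x0|x0] := leP x 1.
    move: (gfd x ltac:(lra)) (fge x ltac:(lra)); rewrite /= !thompson1 => -> ->.
    by rewrite (mulrC m n).
  by rewrite !(thompson_out _ (x := x)) ?in_itv /=; lra.
have [d d0 fgd] := comm0; have [e e0 fge] := comm1.
exists (Num.min d e) => [|x]; first by rewrite lt_min d0.
rewrite lerBlDr -lerBlDl !le_min => xde.
have fgx : f (g x) = g (f x).
  by case: xde => /andP[? ?]; [apply: fgd|apply: fge]; lra.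
by rewrite commgEl conjgE !thompsonME fgx !thompsonK.
Qed.

(** * Orbits of a map that pushes $(0,1)$ to the right *)

Section Escape.
Variables (h : thompsonF R) (hgt : forall x, 0 < x < 1 -> x < h x).

(** Otherwise the orbit of [a] has a supremum $s$ in $(0,1)$. As $h^{-1}(s) < s$, some orbit point
    exceeds $h^{-1}(s)$, and the next one exceeds $s$. *)
Lemma pushing_escape a b : 0 < a < 1 -> b < 1 -> exists n, b < (h ^+ n)%g a.
Proof.
move=> a01 b1; apply: contrapT => /forallNP hn.
pose S := [set (h ^+ n)%g a | n in [set: nat]].
have Sb : ubound S b by move=> _ [n _ <-]; rewrite leNgt; apply/negP.
have Sa : S a by exists 0%N.
have supS : has_sup S by split; [exists a|exists b].
have as_ : a <= sup S by apply: ub_le_sup => //; exists b.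
have sb : sup S <= b by apply: ge_sup => //; exists a.
have : ((h^-1)%g (sup S) < sup S).
  rewrite -{2}(thompsonVK h (sup S)); apply: hgt.
  by apply: thompson_oo; lra.
move=> /(sup_gt _)[|_ [n _ <-]]; first by exists a.
rewrite -(thompson_lt h) thompsonVK -thompsonME -expgS ltNge => /negP; apply.
by apply: ub_le_sup; [exists b|exists n.+1].
Qed.

Lemma pushing_escapeV a b : 0 < a -> 0 < b < 1 -> exists n, (h ^- n)%g b < a.
Proof.
move=> a0 b01; have [ab|ba] := ltP b a; first by exists 0%N; rewrite expg0 invg1.
have [n bn] : exists n, b < (h ^+ n)%g a by apply: pushing_escape; lra.
by exists n; rewrite -(thompson_lt (h ^+ n)%g) thompsonVK.
Qed.

Lemma pushing_le n x : 0 < x < 1 -> x <= (h ^+ n)%g x.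
Proof.
elim: n => [|n IH] x01; first by rewrite expg0.
rewrite expgS thompsonME; apply: le_trans (IH x01) (ltW (hgt _)).
exact: thompson_oo.
Qed.

(* [h * f] agrees with [h] off the support of [f]; as [h] moves [e] past
   [1 - e], an orbit of [h * f] meets that support only once. *)
Lemma pushing_mulX f e n m x : 0 < e -> e < 2^-1 -> fixes_ends e f ->
  1 - e < h e -> e <= x <= 1 - e ->
  ((h * f) ^+ (n.+1 + m))%g ((h ^- m)%g x) = (h ^+ n.+1)%g (f x).
Proof.
move=> e0 e2 fe he xe.
have past k y : 1 - e <= y < 1 -> ((h * f) ^+ k)%g y = (h ^+ k)%g y.
  elim: k y => // k IH y ye; rewrite !expgSr !thompsonME fe; last by right; lra.
  apply: IH; have y01 : 0 < y < 1 by lra.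
  by have := hgt y01; have := thompson_oo h y01; lra.
have before k y : 0 < y -> y <= 1 - e ->
    ((h * f) ^+ k)%g ((h ^- k)%g y) = y.
  elim: k y => [|k IH] y y0 ye; first by rewrite expg0 invg1.
  have hV : 0 < (h^-1)%g y < 1 by apply: thompson_oo; lra.
  (* Since [h e] is past [1 - e], the orbit up to this point stays below [e], where [f] is
     trivial. *)
  have hVe : (h^-1)%g y < e by rewrite -(thompson_lt h) thompsonVK; lra.
  rewrite !expgS invgM !thompsonME IH; [|lra|lra].
  by rewrite fe ?thompsonVK //; left; lra.
rewrite expgnDr thompsonME before; [|lra|lra].
rewrite !expgSr !thompsonME past //.
have fx : e <= f x by rewrite -(fe e) ?thompson_le; [lra|left].
have : h e <= h (f x) by rewrite thompson_le.
have /(thompson_oo f)/(thompson_oo h) : 0 < x < 1 by lra.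
lra.
Qed.

End Escape.

Lemma push_exists : exists h, forall x, 0 < x < 1 -> x < h x.
Proof. by exists (ThompsonF push_thompson) => x; exact: push_gt. Qed.

(** * A classful subgroup is the whole group *)

Section Classful.
Variables (H : set (thompsonF R)) (Hsub : subgroup H) (Hcl : classful H).

Let HM f g : f \in H -> g \in H -> (f * g)%g \in H.
Proof. exact: (group_closedM Hsub). Qed.

Let HV f : f \in H -> (f^-1)%g \in H.
Proof. exact: (group_closedV Hsub). Qed.

Let HX f n : f \in H -> (f ^+ n)%g \in H.
Proof.
move=> fH; elim: n => [|n IH]; first by rewrite expg0; case: Hsub.
by rewrite expgS HM.
Qed.

(* Correct a conjugator [c] by an element of [H] conjugate to [c]. *)
Lemma classful_compact f : exists2 c, compactly_supported c & (f ^ c)%g \in H.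
Proof.
have [c fc] := Hcl f; have [d cd] := Hcl c.
exists (c * (c ^ d)^-1)%g; last first.
  by rewrite conjgM conjgE invgK; exact: HM cd (HM fc (HV cd)).
have := commutator_compact (c^-1)%g d.
by rewrite commgEl invgK conjVg.
Qed.

Lemma classful_push e : 0 < e -> e < 2^-1 -> exists h,
  [/\ h \in H, forall x, 0 < x < 1 -> x < h x & 1 - e < h e].
Proof.
move=> e0 e2; have [h0 h0gt] := push_exists; have [c hH] := Hcl h0.
have hgt x : 0 < x < 1 -> x < (h0 ^ c)%g x.
  move=> x01; rewrite conjgE !thompsonME -(thompson_lt c) thompsonVK.
  exact/h0gt/thompson_oo.
have e01 : 0 < e < 1 by lra.
have [n hn] : exists n, 1 - e < ((h0 ^ c) ^+ n)%g e.
  by apply: pushing_escape => //; lra.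
(* The first [n] steps give a weak inequality; the extra one makes it strict. *)
exists ((h0 ^ c) ^+ n.+1)%g; split; first exact: HX.
  move=> x x01; rewrite expgS thompsonME.
  exact: le_lt_trans (pushing_le hgt n x01) (hgt _ (thompson_oo _ x01)).
rewrite expgS thompsonME; apply: lt_trans hn (hgt _ _).
exact: thompson_oo.
Qed.

Lemma classful_approx f e : 0 < e -> e < 2^-1 -> fixes_ends e f ->
  exists2 k, k \in H & forall x, e <= x <= 1 - e -> k x = f x.
Proof.
move=> e0 e2 fe; have [h [hH hgt he]] := classful_push e0 e2.
have [c [d d0 cd] gc] := classful_compact (h * f)%g.
have e01 : 0 < e < 1 by lra.
(* [n] and [m] carry $[e, 1-e]$ forwards and backwards into the margins of width [d] fixed by [c].
   In [(h * f) ^ c], [c] acts first and its inverse last, and both meet only points there. *)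
have [n hn] : exists n, 1 - d < (h ^+ n)%g e.
  by apply: pushing_escape => //; lra.
have [m hm] : exists m, (h ^- m)%g (1 - e) < d.
  by apply: pushing_escapeV => //; lra.
exists (h ^- n.+1 * ((h * f) ^ c) ^+ (n.+1 + m) * h ^- m)%g.
  exact: HM (HM (HV (HX n.+1 hH)) (HX (n.+1 + m) gc)) (HV (HX m hH)).
move=> x xe; rewrite -conjXg conjgE !thompsonME.
have -> : c ((h ^- m)%g x) = (h ^- m)%g x.
  by apply: cd; left; apply: le_trans (ltW hm); rewrite thompson_le; lra.
rewrite (pushing_mulX hgt n m e0 e2 fe he xe).
have -> : (c^-1)%g ((h ^+ n.+1)%g (f x)) = (h ^+ n.+1)%g (f x).
  apply: (fixes_endsV cd); right; apply: le_trans (ltW hn) _.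
  have fx : e <= f x by rewrite -(fe e) ?thompson_le; [lra|left].
  apply: (@le_trans _ _ ((h ^+ n)%g (f x))); first by rewrite thompson_le.
  rewrite expgS thompsonME ltW // hgt //; do 2 apply: thompson_oo; lra.
by rewrite thompsonK.
Qed.

(** With [k] in [H] agreeing with [c] on $[e, 1-e]$, conjugating [f ^ c] back by [k] gives [f]
    there, because [f ^ c] preserves that interval. In the margins [f] and [f ^ c] are trivial and
    [k] cancels. *)
Lemma classful_compact_mem f : compactly_supported f -> f \in H.
Proof.
move=> fC; have [c cC vH] := classful_compact f.
have [e [e0 e2 fe ce]] := compactly_supported_common fC cC.
have [k kH kc] := classful_approx e0 e2 ce.
have ve : fixes_ends e (f ^ c)%g.
  by rewrite conjgE; apply/fixes_endsM/fixes_endsM => //; exact: fixes_endsV.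
suff -> : f = (k * (f ^ c) * k^-1)%g by exact: HM (HM kH vH) (HV kH).
apply: thompsonF_inj => y; rewrite (thompsonME (k * f ^ c)%g) (thompsonME k).
(* Substituting [k y] for [y] turns the goal into [f (k y) = k ((f ^ c) y)]. *)
rewrite -{1}(thompsonVK k y); move: ((k^-1)%g y) => {}y.
have [ye|ye] := boolP (e <= y <= 1 - e).
  have vy : e <= (f ^ c)%g y <= 1 - e.
    move: ye; rewrite -(thompson_le (f ^ c)%g e y).
    rewrite -(thompson_le (f ^ c)%g y (1 - e)).
    by rewrite (ve e (or_introl (lexx _))) (ve (1 - e) (or_intror (lexx _))).
  by rewrite !kc // conjgE !thompsonME thompsonVK.
have ye' : y <= e \/ 1 - e <= y by lra.
rewrite ve // fe //.
(* Nothing else is known of [k] in the margins, but fixing [e] and [1 - e] it maps each margin to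
   itself by monotonicity. *)
have ke : k e = e by rewrite kc ?ce //; [left|lra].
have k1e : k (1 - e) = 1 - e by rewrite kc ?ce //; [right|lra].
move: ye'; rewrite -(thompson_le k y e) -(thompson_le k (1 - e) y).
by rewrite ke k1e.
Qed.

Lemma classful_mem f : f \in H.
Proof.
have [c fc] := Hcl f.
have -> : f = (f ^ c * [~ f, c]^-1)%g by rewrite commgEl invgM invgK mulVKg.
exact/(HM fc)/HV/classful_compact_mem/commutator_compact.
Qed.

End Classful.
End ThompsonAction.

Theorem theorem1 (R : realType) : invariably_generated (thompsonF R).
Proof.
by move=> H Hsub Hcl; apply/seteqP; split=> // f _; apply/set_mem/classful_mem.
Qed.
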